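(* Let $G$ be a finite group, let $\chi\in\mathrm{Irr}(G)$, and set $K=\ker(\chi)$. Assume that one of the following holds: (1) $K\nleq \mathbf{F}(G)$; or (2) $K=\mathbf{F}(G)<\mathrm{Sol}(G)$ (proper containment). Then there exists $\xi\in\mathrm{Irr}(G)$ such that $\ker(\xi)<K$ (proper containment) and $\mathrm{cod}(\xi)>\mathrm{cod}(\chi)$.
   Context: All groups are finite and all characters are complex characters; $\mathrm{Irr}(G)$ is the set of irreducible complex characters of $G$. For $\chi\in\mathrm{Irr}(G)$, $\ker(\chi)=\{g\in G:\chi(g)=\chi(1)\}$, and the codegree of $\chi$ is $\mathrm{cod}(\chi)=|G:\ker(\chi)|/\chi(1)$. $\mathbf{F}(G)$ denotes the Fitting subgroup of $G$ (the largest nilpotent normal subgroup), and $\mathrm{Sol}(G)$ denotes the solvable radical of $G$ (the largest solvable normal subgroup). *)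

(* Defs.v *)
From HB Require Import structures.
From mathcomp Require Import all_boot all_order all_algebra all_fingroup.
From mathcomp Require Import all_solvable all_field all_character.

Set Implicit Arguments.
Unset Strict Implicit.
Unset Printing Implicit Defensive.

Import GroupScope Order.TTheory GRing.Theory Num.Theory.

(* For characters, MathComp's cfker phi is [set x in G | phi x == phi 1]
   (cfkerEchar, cfkerEirr). *)
Definition cod (gT : finGroupType) (G : {group gT}) (phi : 'CF(G)) : algC :=
  (#|G : cfker phi|%:R / phi 1%g)%R.

Section SolvableRadical.

Variable gT : finGroupType.
Implicit Types G H N : {group gT}.

Definition Sol (A : {set gT}) : {set gT} :=
  <<\bigcup_(N : {group gT} | (N <| A) && solvable N) N>>.

Canonical Sol_group (A : {set gT}) := Eval hnf in [group of Sol A].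

Lemma Sol_max G N : N <| G -> solvable N -> N \subset Sol G.
Proof.
move=> nsNG solN; apply: sub_gen.
by apply: (bigcup_max N); rewrite // nsNG.
Qed.

Lemma solvable_mul_normal G H N :
  H <| G -> N <| G -> solvable H -> solvable N -> solvable (H <*> N).
Proof.
move=> nsHG nsNG solH solN.
have nNH: H \subset 'N(N).
  exact: subset_trans (normal_sub nsHG) (normal_norm nsNG).
have nsN: N <| H <*> N by rewrite /normal joing_subr join_subG nNH normG.
by rewrite (series_sol nsN) solN quotientYidr // quotient_sol.
Qed.

Lemma Sol_normal_sol G : (Sol G <| G) && solvable (Sol G).
Proof.
pose P (A : {set gT}) := (<<A>> <| G) && solvable <<A>>.
apply: (big_ind P) => [|A B /andP[nA sA] /andP[nB sB]|N /andP[nN sN]].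
- by rewrite /P gen0 normal1 solvable1.
- have -> : P (A :|: B) = P (<<A>> <*> <<B>>).
    by rewrite /P joing_idl joing_idr genGid.
  rewrite /P genGid normalY //=; exact: solvable_mul_normal nA nB sA sB.
- by rewrite /P genGid nN.
Qed.

Lemma Sol_normal G : Sol G <| G.
Proof. by case/andP: (Sol_normal_sol G). Qed.

Lemma Sol_sol G : solvable (Sol G).
Proof. by case/andP: (Sol_normal_sol G). Qed.

End SolvableRadical.

(* Main.v *)
Require Import Defs.
From HB Require Import structures.
From mathcomp Require Import all_boot all_order all_algebra all_fingroup.
From mathcomp Require Import all_solvable all_field all_character.
Import GroupScope Order.TTheory GRing.Theory Num.Theory.

(** Write K for the kernel of chi.  If M is a maximal subgroup of G that does
    not contain K, then G = MK, so chi restricts irreducibly to M, and by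
    Frobenius reciprocity chi occurs exactly once in the character induced
    from this restriction.  Any other constituent xi has degree at most
    (|G : M| - 1) chi(1), where |G : M| = |K : K :&: M|.  If the kernel D of xi
    lies in M, then it lies in K :&: M, so that passing from chi to xi
    multiplies the index of the kernel by at least |G : M| but the degree by
    less than that: the codegree grows.

    The only obstruction (larger_codegree_or_twin_kernel) is that D is also not
    contained in M; then xi and chi agree on M, and D is a normal twin of K:
    both supplement M and the three intersections K :&: M, D :&: M and D :&: K
    coincide.  A good choice of M rules this out (larger_codegree_Sylow).
    Let N = KP be normal in G, where P is a Sylow p-subgroup of N that is not
    normal in G, and let M contain the normalizer of P, so that G = KM by the
    Frattini argument.  As M contains the Sylow p-subgroup K :&: P of K, its
    index is prime to p; since |D : D :&: K| is that index while N / K is a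
    p-group, N :&: D lies in K.  Thus P centralizes D modulo K, and because K
    and D are twins over M, this transfers to P centralizing K modulo
    L = D :&: K.  Then PL is normal in N = KP, and a second Frattini argument
    gives N = PL N_N(P), which lies in M although K does not.

    Such N and P exist under either hypothesis.  If K is not contained in the
    Fitting subgroup, some Sylow subgroup P of K is not normal in G, and N = K
    works.  If K = F(G) < Sol(G), the Fitting subgroup of Sol(G) / K is
    nontrivial; take for N / K one of its nontrivial p-cores.  If P were normal
    in G it would be contained in F(G) = K, which would force N = K. *)

(** * Characters whose kernel is supplemented by a subgroup *)

(** G and M have the same image in the representation affording chi. *)
Lemma irr_Res_supplement (gT : finGroupType) (G M : {group gT})
    (chi : 'CF(G)) :
  chi \in irr G -> M * cfker chi = G -> 'Res[M]%R chi \in irr M.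
Proof.
move=> /irr_reprP[rG irrG ->]; rewrite cfker_repr => defG.
have sMG: M \subset G by rewrite -defG mulG_subl.
apply/irr_reprP; exists (Representation (subg_repr rG sMG)); last first.
  by rewrite /= -cfRepr_sub.
have [_ nz1 simG] := irrG; split=> //; first exact: mxmodule1.
move=> U modU sU1 nzU; apply: simG => //.
apply/mxmoduleP=> g; rewrite -{1}defG => /mulsgP[m k Mm Kk ->].
have /setIdP[Gk /eqP] := Kk; rewrite mul1mx => rk1.
rewrite (repr_mxM rG) ?(subsetP sMG m) // rk1 mulmx1.
by have /mxmoduleP/(_ m Mm) := modU.
Qed.

Lemma cfRes_supplement_inj (gT : finGroupType) (G K M : {group gT})
    (phi psi : 'CF(G)) :
    M * K = G -> K \subset cfker phi -> K \subset cfker psi ->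
  'Res[M]%R phi = 'Res[M]%R psi -> phi = psi.
Proof.
move=> defG kerKphi kerKpsi eqM.
have sMG: M \subset G by rewrite -defG mulG_subl.
apply/cfun_inP=> g; rewrite -{1}defG => /mulsgP[m k Mm Kk ->].
rewrite !cfkerMr ?(subsetP kerKphi) ?(subsetP kerKpsi) //.
by rewrite -(cfResE _ sMG Mm) eqM cfResE.
Qed.

Lemma mulg_maximal_normal (gT : finGroupType) (G M H : {group gT}) :
  maximal M G -> H <| G -> ~~ (H \subset M) -> M * H = G.
Proof.
case/maxgroupP=> /andP[sMG _] maxM /andP[sHG nHG]; apply: contraNeq => neqMH.
rewrite -(maxM (M <*> H)%G) ?joing_subl ?joing_subr //=.
by rewrite norm_joinEl ?(subset_trans sMG) // properEneq neqMH mul_subG //.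
Qed.

(** * Characters induced from a maximal supplement of the kernel *)

(** The dichotomy is whether or not D, the kernel of a second constituent of the
    character induced from the restriction of chi to M, is contained in M. *)
Lemma larger_codegree_or_twin_kernel (gT : finGroupType) (G M : {group gT})
    (chi : 'CF(G)) (K := cfker chi) :
    chi \in irr G -> maximal M G -> ~~ (K \subset M) ->
  (exists xi : 'CF(G),
    [/\ xi \in irr G, cfker xi \proper K & (cod chi < cod xi)%R])
  \/ (exists D : {group gT},
       [/\ D <| G, M * D = G, D :&: M = K :&: M & D :&: K = K :&: M]).
Proof.
move=> irr_chi maxM sK'M; have [sMG ltMG] := andP (maxgroupp maxM).
have nsKG: K <| G := cfker_normal chi.
have defG : M * K = G by apply: mulg_maximal_normal.
have irrM: ('Res[M] chi \in irr M)%R by apply: irr_Res_supplement.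
have Nchi := irrWchar irr_chi.
have Nind: ('Ind[G] ('Res[M] chi) \is a character)%R.
  by rewrite cfInd_char ?cfRes_char.
(* chi occurs with multiplicity one, so phi below does not involve it. *)
have ind_chi: ('['Ind[G] ('Res[M] chi), chi] = 1)%R.
  by rewrite -cfdot_Res_r; have /irrP[j ->] := irrM; rewrite cfnorm_irr.
have [i def_chi] := irrP irr_chi.
have ind_i: i \in irr_constt ('Ind[G] ('Res[M] chi))%R.
  by rewrite irr_consttE -def_chi ind_chi oner_eq0.
have [phi Nphi def_phi] := constt_charP _ Nind ind_i.
rewrite -def_chi in def_phi.
have iM_gt1: (1 < #|G : M|)%N by rewrite indexg_gt1.
have chi1_gt0: (0 < chi 1%g)%R by rewrite def_chi irr1_gt0.
have phi1: (phi 1%g = (#|G : M|%:R - 1) * chi 1%g)%R.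
  have := cfInd1 ('Res[M] chi)%R sMG; rewrite def_phi cfRes1 cfunE => e.
  by rewrite mulrBl mul1r -e addrC addKr.
have phi_nz: phi != 0%R.
  apply: contraTneq iM_gt1 => phi0; have/eqP := phi1.
  rewrite phi0 cfunE eq_sym mulf_eq0 (gt_eqF chi1_gt0) orbF subr_eq0.
  by rewrite pnatr_eq1 => /eqP->.
have [j phi_j] := neq0_has_constt phi_nz.
have neq_ij: i != j.
  apply: contraTneq phi_j => <-; rewrite irr_consttE negbK -def_chi.
  have/eqP := ind_chi; rewrite def_phi cfdotDl {1 2}def_chi cfnorm_irr.
  by rewrite -{2}[1%R]addr0 (inj_eq (addrI _)).
pose xi := ('chi_j)%R; pose D := cfker xi.
have nsDG: D <| G := cfker_normal xi.
have ind_j: j \in irr_constt ('Ind[G] ('Res[M] chi))%R.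
  rewrite irr_consttE def_phi cfdotDl def_chi cfdot_irr (negPf neq_ij) add0r.
  exact: phi_j.
have [m def_chiM] := irrP irrM.
have res_j: m \in irr_constt ('Res[M] xi)%R.
  by rewrite -constt_Ind_Res -def_chiM.
have Nxi : xi \is a character := irr_char j.
have sDMK: M :&: D \subset M :&: K.
  rewrite -!cfker_Res // def_chiM; apply: cfker_constt res_j.
  by rewrite cfRes_char.
have [sDM | sD'M] := boolP (D \subset M); [left | right].
  have sDKM: D \subset M :&: K.
    by rewrite (subset_trans _ sDMK) // subsetI sDM /=.
  have sDK: D \subset K := subset_trans sDKM (subsetIr _ _).
  exists xi; split; rewrite ?mem_irr //.
    by rewrite properE sDK; apply: contra sK'M => /subset_trans->.
  have le_iM: (#|G : M| <= #|K : D|)%N.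
    have ->: #|G : M| = #|K : M| by rewrite -[in RHS]indexMg defG.
    by rewrite -indexgI setIC dvdn_leq // indexgS.
  have xi1_gt0: (0 < xi 1%g)%R := irr1_gt0 j.
  have lt_xi1: (xi 1%g < #|K : D|%:R * chi 1%g)%R.
    apply: le_lt_trans (char1_ge_constt Nphi phi_j) _.
    rewrite phi1 ltr_pM2r // ltrBlDr (le_lt_trans (y := #|K : D|%:R)%R) //.
      by rewrite ler_nat.
    by rewrite ltrDl ltr01.
  rewrite /cod ltr_pdivrMr // mulrAC ltr_pdivlMr // -/K -/D.
  rewrite -(Lagrange_index (normal_sub nsKG) sDK) natrM -mulrA.
  by rewrite ltr_pM2l ?ltr0n.
have defGD : M * D = G by apply: mulg_maximal_normal.
have irrMxi: ('Res[M] xi \in irr M)%R.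
  by apply: irr_Res_supplement; rewrite ?mem_irr.
have eqM: ('Res[M] xi = 'Res[M] chi)%R.
  have [l def_l] := irrP irrMxi; move: res_j; rewrite def_l def_chiM.
  by rewrite constt_irr inE => /eqP->.
have eqDK: M :&: D = M :&: K by rewrite -!cfker_Res // eqM.
exists [group of D]; split=> //; first by rewrite setIC eqDK setIC.
(* Otherwise G = M (D :&: K), and xi and chi, which agree on M and have D :&: K
   in their kernels, would be equal. *)
have sDKM: D :&: K \subset M.
  apply/idPn => sDK'M.
  have defGDK : M * (D :&: K) = G.
    apply: (@mulg_maximal_normal _ _ _ [group of D :&: K]) => //.
    by rewrite normalI.
  have eqxi: xi = chi.
    apply: (@cfRes_supplement_inj _ G [group of D :&: K] M) => //=.
      exact: subsetIl.
    exact: subsetIr.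
  by case/eqP: neq_ij; apply: irr_inj; rewrite -def_chi -eqxi.
by rewrite -[LHS](setIidPr sDKM) setIA eqDK -setIA setIid setIC.
Qed.

(** * Excluding twin kernels with a Sylow normalizer *)

(** A twin D of K cannot exist when M contains the normalizer of P: as N / K and
    DK / K have coprime orders, P acts trivially on DK / K, hence also on
    K / (D :&: K). *)
Lemma larger_codegree_Sylow (gT : finGroupType) (G N P : {group gT}) (p : nat)
    (chi : 'CF(G)) (K := cfker chi) :
    chi \in irr G -> N <| G -> p.-Sylow(N) P -> K * P = N -> ~~ (P <| G) ->
  exists xi : 'CF(G),
    [/\ xi \in irr G, cfker xi \proper K & (cod chi < cod xi)%R].
Proof.
move=> irr_chi nsNG sylP defN not_nPG.
have nsKG : K <| G := cfker_normal chi.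
have [sKG nKG] := andP nsKG; have [sNG nNG] := andP nsNG.
have sKN: K \subset N by rewrite -defN mulG_subl.
have [sPN pP _] := and3P sylP; have sPG := subset_trans sPN sNG.
have defKN: K * 'N_G(P) = G.
  apply/eqP; rewrite eqEsubset mul_subG ?subsetIl //=.
  rewrite -{1}(Frattini_arg nsNG sylP) -defN -mulgA mulgS //.
  by rewrite mul_subG // subsetI sPG normG.
have [eqN | [M maxM sNM]] := maximal_exists (subsetIl G 'N(P)).
  by case/negP: not_nPG; rewrite /normal sPG -eqN subsetIr.
have sMG: M \subset G by case/andP: (maxgroupp maxM).
have sPM: P \subset M by rewrite (subset_trans _ sNM) // subsetI sPG normG.
have sK'M: ~~ (K \subset M).
  apply/negP=> sKM; case/andP: (maxgroupp maxM) => _ /negP[].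
  by rewrite -defKN mul_subG.
have [// | [D [nsDG defGD eqDM eqDK]]] :=
  larger_codegree_or_twin_kernel _ _ _ _ irr_chi maxM sK'M.
rewrite -/K in eqDM eqDK.
have [sDG nDG] := andP nsDG.
have p'iM: p^'.-nat #|G : M|.
  have ->: #|G : M| = #|K : M|.
    by rewrite -[in RHS]indexMg (mulg_maximal_normal _ _ _ _ maxM nsKG).
  have nsKN: K <| N by rewrite /normal sKN (subset_trans sNG).
  have [_ _] := and3P (Sylow_setI_normal nsKN sylP).
  rewrite -[in #|K : M|]indexgI; apply: pnat_dvd.
  by rewrite indexgS // setIS.
(* (N :&: D) K / K is both a p-group and a p'-group. *)
have sNDK: N :&: D \subset K.
  have nKN: N \subset 'N(K) := subset_trans sNG nKG.
  rewrite -quotient_sub1 ?(subset_trans (subsetIl _ _)) //.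
  rewrite subG1; apply/eqP/card1_trivg/(@pnat_1 p).
    apply: pgroupS (quotientS K (subsetIl N D)) _.
    by rewrite /= -defN quotientMidl quotient_pgroup.
  apply: pgroupS (quotientS K (subsetIr N D)) _.
  rewrite /pgroup card_quotient ?(subset_trans sDG) //.
  by rewrite -indexgI eqDK -eqDM indexgI -[#|_ : _|]indexMg defGD.
(* For k = m * d in K, with m in M and d in D, both [~ x, k] and [~ x, d] lie
   in K, hence so does [~ x, m]; it also lies in M, so it lies in D. *)
have sPKD: [~: P, K] \subset D.
  rewrite gen_subG; apply/subsetP=> _ /imset2P[x k Px Kk ->].
  have Gx := subsetP sPG x Px; have Gk := subsetP sKG k Kk.
  have: k \in M * D by rewrite defGD.
  case/mulsgP=> m d Mm Dd def_k; have Gd := subsetP sDG d Dd.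
  have Dcomm y : y \in D -> [~ x, y] \in D.
    by move=> Dy; rewrite commgEr groupM // memJ_norm ?groupV // (subsetP nDG).
  have Kxm: [~ x, m] \in K.
    have ->: m = k * d^-1 by rewrite def_k mulgK.
    rewrite commgMJ groupM //.
      apply: (subsetP sNDK); rewrite inE Dcomm ?groupV // andbT.
      have Nx := subsetP sPN x Px.
      by rewrite commgEl groupM ?groupV // memJ_norm // groupV (subsetP nNG).
    rewrite memJ_norm ?groupV ?(subsetP nKG) // commgEr groupM //.
    by rewrite memJ_norm ?groupV // (subsetP nKG).
  have Dxm: [~ x, m] \in D.
    have: [~ x, m] \in K :&: M by rewrite inE Kxm groupR // (subsetP sPM).
    by rewrite -eqDM => /setIP[].
  by rewrite def_k commgMJ groupM ?Dcomm // memJ_norm // (subsetP nDG).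
pose L := (D :&: K)%G.
have [sLG nLG]: L \subset G /\ G \subset 'N(L).
  by apply/andP/(normalI nsDG nsKG).
have sLM: L \subset M by rewrite /= eqDK subsetIr.
have nKPL: K \subset 'N(P <*> L).
  rewrite -commg_subr commGC (@subset_trans _ _ L) ?joing_subr //.
  rewrite -quotient_cents2 ?(subset_trans _ nLG) ?join_subG ?sPG //.
  rewrite quotientYidr ?(subset_trans sPG) //.
  rewrite quotient_cents2 ?(subset_trans _ nLG) // subsetI sPKD.
  by rewrite commg_subr (subset_trans sPG).
have nsPLN: P <*> L <| N.
  rewrite /normal join_subG sPN (subset_trans (subsetIr _ _) sKN) /=.
  by rewrite -defN mul_subG // (subset_trans (joing_subl _ L)) ?normG.
case/negP: sK'M; apply: subset_trans sKN _.
have sylPL: p.-Sylow(P <*> L) P.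
  by apply: pHall_subl sylP; rewrite ?joing_subl ?(normal_sub nsPLN).
rewrite -(Frattini_arg nsPLN sylPL) mul_subG ?join_subG ?sPM //.
by apply: subset_trans sNM; apply: setSI.
Qed.

(** * Codegrees and the Fitting subgroup *)

Theorem theorem1p1 (gT : finGroupType) (G : {group gT}) (chi : 'CF(G)) :
  chi \in irr G ->
  ~~ (cfker chi \subset 'F(G)) \/
    (cfker chi = 'F(G) /\ 'F(G) \proper Sol G) ->
  exists xi : 'CF(G),
    [/\ xi \in irr G, cfker xi \proper cfker chi & (cod chi < cod xi)%R].
Proof.
move=> irr_chi [not_nilK | [defK ltFS]].
  have [P sylP not_nPG]:
    exists2 P : {group gT}, Sylow (cfker chi) P & ~~ (P <| G).
    apply/exists_inP; apply: contraR not_nilK.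
    rewrite negb_exists_in => /forall_inP nP.
    rewrite -{1}(Sylow_gen [group of cfker chi]) gen_subG.
    apply/bigcupsP=> P sylP.
    have /SylowP[p _ sylpP] := sylP.
    rewrite Fitting_max ?(pgroup_nil (pHall_pgroup sylpP)) //.
    by have:= nP P sylP; rewrite negbK.
  have /SylowP[p _ sylpP] := sylP.
  apply: (@larger_codegree_Sylow gT G [group of cfker chi] P p) => //.
    exact: cfker_normal.
  by rewrite mulGSid // (pHall_sub sylpP).
set K := cfker chi in defK *; have nsKG: K <| G := cfker_normal chi.
have sKS: K \subset Sol G by rewrite defK proper_sub.
have nsKS: K <| Sol G := normalS sKS (normal_sub (Sol_normal G)) nsKG.
have [p ntF]: exists p : nat, 'O_p('F(Sol G / K)) != 1.
  have ntF: 'F(Sol G / K) != 1.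
    rewrite trivg_Fitting ?quotient_sol ?Sol_sol //.
    rewrite -subG1 quotient_sub1 ?normal_norm //= -/K defK.
    by case/andP: ltFS.
  pose p := pdiv #|'F(Sol G / K)|; exists p.
  have sylO := nilpotent_pcore_Hall p (Fitting_nil (Sol G / K)).
  rewrite -cardG_gt1 (card_Hall sylO) p_part_gt1 mem_primes.
  by rewrite pdiv_prime ?cardG_gt1 // cardG_gt0 pdiv_dvd.
have nsOG: 'O_p('F(Sol G / K)) <| G / K.
  apply: (char_normal_trans (pcore_char _ _)).
  apply: (char_normal_trans (Fitting_char _)).
  by rewrite quotient_normal ?Sol_normal.
have [N defO sKN nsNG] := inv_quotientN nsKG nsOG.
have [P sylP] := Sylow_exists p N.
have nsKN: K <| N := normalS sKN (normal_sub nsNG) nsKG.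
have defN: K * P = N.
  have nKP := subset_trans (pHall_sub sylP) (normal_norm nsKN).
  have /pHall_id eqPN := quotient_pHall nKP sylP.
  rewrite -(quotientK nKP) eqPN ?quotientGK //.
  by have := pcore_pgroup p 'F(Sol G / K); rewrite defO.
apply: (@larger_codegree_Sylow gT G N P p) => //.
apply: contra ntF => nsPG.
rewrite defO -defN quotientMidl -subG1 quotient_sub1.
  by rewrite /= -/K defK Fitting_max ?(pgroup_nil (pHall_pgroup sylP)).
by rewrite (subset_trans (pHall_sub sylP)) ?normal_norm.
Qed.
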